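(* Let $\Delta$ be a simplicial tree on the vertex set $\{x_1,\dots,x_n\}$, let $\mathbb{K}$ be a field, let $S=\mathbb{K}[x_1,\dots,x_n]$, and let $J(\Delta)\subset S$ be the vertex cover ideal of $\Delta$. Then for every integer $k\ge 1$, the ideal $J(\Delta)^k$ has linear quotients, and hence it is componentwise linear.
   Context: Let $\Delta$ be a simplicial complex on $\mathcal{V}=\{x_1,\dots,x_n\}$ with set of facets $\mathcal{F}(\Delta)$ (facets are assumed non-empty). A subcollection of $\Delta$ is a simplicial complex whose set of facets is a subset of $\mathcal{F}(\Delta)$. A facet $F$ of $\Delta$ is a leaf if either $F$ is the only facet of $\Delta$, or there is a facet $G\in\mathcal{F}(\Delta)$, $G\neq F$, such that $F\cap H\subseteq F\cap G$ for every facet $H\in\mathcal{F}(\Delta)$ with $H\neq F$. $\Delta$ is connected if for any two facets $F,F'$ there is a sequence of facets starting at $F$ and ending at $F'$ in which any two consecutive facets have non-empty intersection. $\Delta$ is a simplicial tree if it is connected and every non-empty subcollection of $\Delta$ has a leaf. For $F\subseteq\mathcal{V}$ let $\wp_F$ be the prime ideal of $S$ generated by the variables $x_j\in F$. The vertex cover ideal of $\Delta$ is $J(\Delta)=\bigcap_{F\in\mathcal{F}(\Delta)}\wp_F$. A monomial ideal $I$ has linear quotients if its minimal monomial generators can be ordered $u_1,\dots,u_r$ so that for every $i$ the colon ideal $\langle u_1,\dots,u_{i-1}\rangle:\langle u_i\rangle$ is generated by a subset of the variables $\{x_1,\dots,x_n\}$. A graded ideal $I$ is componentwise linear if for every $j$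 the ideal $I_{\langle j\rangle}$ generated by all homogeneous elements of $I$ of degree $j$ has a linear resolution. A finitely generated graded $S$-module $M$ with graded Betti numbers $\beta_{i,j}(M)=\dim_{\mathbb{K}}\operatorname{Tor}^S_i(M,\mathbb{K})_j$ has a linear resolution if there is an integer $d$ such that $\beta_{i,i+b}(M)=0$ for all $i$ and all $b\neq d$. *)

(* Defs.v *)
From HB Require Import structures.
From mathcomp Require Import all_boot all_order all_algebra.
From mathcomp Require Export mpoly.

Set Implicit Arguments.
Unset Strict Implicit.
Unset Printing Implicit Defensive.

Import GRing.Theory.
Local Open Scope ring_scope.

Section SimplicialComplexes.
Context {n : nat}.
Implicit Types (D E : {set {set 'I_n}}) (F G H : {set 'I_n}).

(* The vertex x_(i+1) is the ordinal i, and a complex is its set of faces.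
   Not every vertex is required to be a face. *)
Definition simplicial_complex D : Prop :=
  forall F G, F \in D -> G \subset F -> G \in D.

Definition facets D : {set {set 'I_n}} := [set F | maxset (mem D) F].

Definition subcollection E D : Prop :=
  simplicial_complex E /\ facets E \subset facets D.

Definition is_leaf D F : Prop :=
  F \in facets D /\
  (facets D = [set F] \/
   exists G, [/\ G \in facets D, G != F &
     forall H, H \in facets D -> H != F -> F :&: H \subset F :&: G]).

Definition complex_connected D : Prop :=
  forall F F', F \in facets D -> F' \in facets D ->
  exists s : seq {set 'I_n},
    [/\ all (mem (facets D)) s, path (fun A B => A :&: B != set0) F s &
        last F s = F'].

(* A complex with no facet at all is the empty one; the complex {set0} is
   excluded by the requirement that facets be non-empty. *)
Definition simplicial_tree D : Prop :=
  [/\ simplicial_complex D,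
      set0 \notin facets D,
      complex_connected D &
      forall E, subcollection E D -> facets E != set0 ->
        exists F, is_leaf E F].

End SimplicialComplexes.

Section Ideals.
Context {n : nat} {K : fieldType}.
Local Notation S := {mpoly K[n]}.
Implicit Types (I J G : S -> Prop).

Definition same_ideal I J : Prop := forall f, I f <-> J f.

Definition ideal_gen G : S -> Prop := fun f =>
  exists s : seq (S * S),
    (forall p, p \in s -> G p.2) /\ f = \sum_(p <- s) p.1 * p.2.

Definition ideal_mul I J : S -> Prop :=
  ideal_gen (fun f => exists a b, [/\ I a, J b & f = a * b]).

Fixpoint ideal_exp I (k : nat) : S -> Prop :=
  if k is k'.+1 then ideal_mul I (ideal_exp I k') else fun _ => True.

Definition ideal_colon I J : S -> Prop :=
  fun f => forall g, J g -> I (f * g).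

Definition var_ideal (F : {set 'I_n}) : S -> Prop :=
  ideal_gen (fun f => exists2 j, j \in F & f = 'X_j).

Definition vertex_cover_ideal (D : {set {set 'I_n}}) : S -> Prop :=
  fun f => forall F, F \in facets D -> var_ideal F f.

Definition monomial_ideal_gen (s : seq 'X_{1..n}) : S -> Prop :=
  ideal_gen (fun f => exists2 m, m \in s & f = 'X_[m]).

Definition minimal_monomial_generators I (s : seq 'X_{1..n}) : Prop :=
  [/\ uniq s, same_ideal I (monomial_ideal_gen s) &
      forall t, {subset t <= s} -> same_ideal I (monomial_ideal_gen t) ->
        {subset s <= t}].

Definition linear_quotients I : Prop :=
  exists s, minimal_monomial_generators I s /\
    forall i, (i < size s)%N ->
      exists A : {set 'I_n},
        same_ideal (ideal_colon (monomial_ideal_gen (take i s))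
                                (monomial_ideal_gen [:: nth 0%MM s i]))
                   (var_ideal A).

Definition graded_ideal I : Prop :=
  forall f, I f -> forall d : nat, I (pihomog mdeg d f).

End Ideals.

Section GradedBetti.
Context {n : nat} {K : fieldType}.
Local Notation S := {mpoly K[n]}.

(* Graded free modules  F_i = \bigoplus_k S(- gdeg k)  of finite rank with maps
     ... -> F_1 -> F_0 -> S,
   where elements of F_i are row vectors and matrices act on the right. *)
Record free_complex := FreeComplex {
  frank : nat -> nat;
  gdeg : forall i, 'I_(frank i) -> int;
  diff : forall i, 'M[S]_(frank i.+1, frank i);
  augm : 'cV[S]_(frank 0)
}.

(* Homogeneous of degree d; for d < 0 this forces p = 0. *)
Definition homog_of_degree (p : S) (d : int) : Prop :=
  forall m, m \in msupp p -> (mdeg m)%:Z = d.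

Definition graded_free_resolution (I : S -> Prop) (C : free_complex) : Prop :=
  [/\ (forall k, homog_of_degree (augm C k 0) (gdeg k)),
      (forall i k l,
         homog_of_degree (diff C i k l) (gdeg k - gdeg l)),
      (forall f, I f <-> exists v : 'rV_(frank C 0), v *m augm C = f%:M),
      (forall v : 'rV_(frank C 0),
         v *m augm C = 0 <-> exists w, v = w *m diff C 0) &
      (forall i (v : 'rV_(frank C i.+1)),
         v *m diff C i = 0 <-> exists w, v = w *m diff C i.+1)].

Section TorDimension.
Variable C : free_complex.

(* K = S/(x_1,...,x_n), so tensoring with K keeps the constant terms. *)
Definition diffK i : 'M[K]_(frank C i.+1, frank C i) :=
  map_mx (mcoeff 0%MM) (diff C i).

Definition degK i (j : int) : 'M[K]_(frank C i) :=
  diag_mx (\row_k (gdeg k == j)%:R).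

Definition cyclesK i : 'M[K]_(frank C i) :=
  match i with 0 => 1%:M | i'.+1 => kermx (diffK i') end.

Definition tor_dim i (j : int) : nat :=
  \rank ((cyclesK i :&: degK i j) :\: (degK i.+1 j *m diffK i))%MS.

End TorDimension.

(* dim_K Tor_i(I, K)_j = b.  Ideals of S with homogeneous generators have
   such resolutions, and Tor does not depend on the one chosen. *)
Definition graded_betti (I : S -> Prop) (i : nat) (j : int) (b : nat) : Prop :=
  exists2 C, graded_free_resolution I C & tor_dim C i j = b.

Definition linear_resolution (I : S -> Prop) : Prop :=
  exists d : int, forall (i : nat) (b : int),
    b != d -> graded_betti I i (i%:Z + b) 0.

Definition degree_component_ideal (I : S -> Prop) (j : nat) : S -> Prop :=
  ideal_gen (fun f => I f /\ f \is j.-homog).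

Definition componentwise_linear (I : S -> Prop) : Prop :=
  graded_ideal I /\
  forall j : nat, linear_resolution (degree_component_ideal I j).

End GradedBetti.

(* Main.v *)
Require Import Defs.
From mathcomp Require Import all_boot all_order all_algebra.
From mathcomp Require Import zify.
From Stdlib Require Import IndefiniteDescription.

(* Leaves yield an elimination order of the vertices: the traces, on the
   vertices not eliminated before x, of the facets through x form a chain.  It
   allows one to split a (k+1)-cover into a 1-cover and a k-cover, so J^k is
   spanned by the monomials having weight at least k on each facet.  For ideals
   given by lower bounds on such weights, the chain condition yields an exchange
   property, hence linear quotients of the minimal generators sorted by degree
   and then lexicographically; the same applies to the components, a lower bound
   on the degree being one more weight constraint.  For the resolution, a
   submodule of a free module whose ideals of leading coordinates are generated
   by variables has syzygies of the same kind, and the syzygies of linear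
   quotients are of this kind. *)

Set Implicit Arguments.
Unset Strict Implicit.
Unset Printing Implicit Defensive.

(** * Families of sets with leaves *)

Section LeafyFamilies.
Context {n : nat}.
Implicit Types (V E F G H : {set 'I_n}) (A B : {set {set 'I_n}}).

Definition has_joint A F G : Prop :=
  [/\ G \in A, G != F &
      forall H, H \in A -> H != F -> F :&: H \subset F :&: G].

(** Facets of a complex are pairwise incomparable, whereas members of [A] may be nested; the leaf
    condition in this generality survives traces, as vertex elimination requires. *)
Definition leafy A : Prop :=
  forall B, B \subset A -> B != set0 ->
  exists2 F, F \in B & B = [set F] \/ exists G, has_joint B F G.

Lemma leafy_subset A B : B \subset A -> leafy A -> leafy B.
Proof. by move=> sBA lA C sCB; apply: lA; apply: subset_trans sBA. Qed.

(** One preimage is chosen for each trace; a leaf and its joint among the chosen sets remain so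
    after intersection with [V]. *)
Lemma leafy_trace A V : leafy A -> leafy [set F :&: V | F in A].
Proof.
move=> lA B sB B0.
pose r F := odflt set0 [pick H in A | H :&: V == F].
have rP F : F \in B -> r F \in A /\ r F :&: V = F.
  move=> /(subsetP sB)/imsetP[H HA ->]; rewrite /r.
  case: pickP => [G /andP[GA /eqP eqG]//|/(_ H)].
  by rewrite HA eqxx.
have [||F FB leafF] := lA (r @: B).
- by apply/subsetP => _ /imsetP[F /rP[? _] ->].
- by case/set0Pn: B0 => F FB; apply/set0Pn; exists (r F); rewrite imset_f.
case/imsetP: FB leafF => F0 F0B -> leafF; exists F0 => //.
case: leafF => [eqB|[G [/imsetP[G0 G0B ->] neG jG]]].
  left; apply/setP => H; rewrite inE; apply/idP/eqP => [HB|-> //].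
  have : r H \in r @: B by rewrite imset_f.
  rewrite eqB inE => /eqP rH.
  by have [_ <-] := rP H HB; have [_ <-] := rP _ F0B; rewrite rH.
right; exists G0; split=> // [|H HB neH].
  by apply: contraNneq neG => ->.
have [_ eF] := rP _ F0B; have [_ eG] := rP _ G0B; have [_ eH] := rP _ HB.
have jH : r F0 :&: r H \subset r F0 :&: r G0.
  apply: jG; first exact: imset_f.
  by apply: contraNneq neH => e; rewrite -eF -eH e.
by rewrite -eF -eH -eG -!setIIl setSI.
Qed.

(** When the empty set occurs beside another member, it is itself a leaf with that member as
    joint. *)
Lemma leafy_set0 A : leafy A -> leafy (set0 |: A).
Proof.
move=> lA B sB B0.
have [/set0Pn[G]|neB] := boolP (B :\ set0 != set0); last first.
  move: neB; rewrite negbK setD_eq0 subset1 (negPf B0) orbF => /eqP ->.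
  by exists set0; [rewrite inE | left].
rewrite !inE => /andP[G0 GB]; have [B0'|nB0] := boolP (set0 \in B).
  by exists set0 => //; right; exists G; split=> // H _ _; rewrite set0I sub0set.
apply: lA => //; apply/subsetP => F FB; have := subsetP sB F FB.
by rewrite !inE => /orP[/eqP e|//]; rewrite -e FB in nB0.
Qed.

(** Analogue of a tree having two leaves. If the leaf found is [M], with joint [G], then a leaf [F']
    of [A :\ M] other than [G] works: [F' :&: M] lies in [F' :&: G], hence in the joint of [F']. *)
Lemma leafy_leaf_neq A M : leafy A -> M \in A -> A != [set M] ->
  exists F G, [/\ F \in A, F != M & has_joint A F G].
Proof.
have [k] := ubnP #|A|; elim: k => // k IHk in A M *; rewrite ltnS => leAk.
move=> lA MA neA; have [||F FA [eA|[G jG]]] := lA A; rewrite ?subxx //.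
- by apply/set0Pn; exists M.
- by move: MA neA; rewrite eA inE => /eqP->; rewrite eqxx.
have [eFM|neFM] := eqVneq F M; last by exists F, G.
case: jG; rewrite {}eFM => GA neGM jM.
have [eA|neAM] := eqVneq (A :\ M) [set G].
  exists G, M; split=> //; split=> // [|H HA neH]; first by rewrite eq_sym.
  have [-> //|neHM] := eqVneq H M.
  have : H \in A :\ M by rewrite !inE neHM.
  by rewrite eA inE (negPf neH).
have GAM : G \in A :\ M by rewrite !inE neGM.
have [||||F' [G' [F'A neF' [G'A neG' jG']]]] := IHk (A :\ M) G => //.
- by rewrite (cardsD1 M A) MA in leAk.
- by apply: leafy_subset lA; apply: subsetDl.
move: F'A G'A; rewrite !inE => /andP[F'M F'A] /andP[G'M G'A].
exists F', G'; split=> //; split=> // H HA neH.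
have [eH|neHM] := eqVneq H M; last by apply: jG'; rewrite // !inE neHM.
apply: subset_trans (jG' G _ _); rewrite 1?eq_sym // eH subsetI subsetIl /=.
by apply: subset_trans (subsetIr M G); rewrite setIC; apply: jM.
Qed.

(* A member meeting a leaf outside its joint is contained in that leaf, so the
   induction hypothesis applies with the leaf as vertex set and the trace of
   the joint as [E]. *)
Lemma leafy_simple_vertex A V E :
  leafy A -> {in A, forall F, F \subset V} -> E \in A -> E != V ->
  exists2 v, v \in V :\: E &
    {in A &, forall F H, v \in F -> v \in H -> (F \subset H) || (H \subset F)}.
Proof.
have [k] := ubnP #|V|; elim: k => // k IHk in A V E *; rewrite ltnS => leVk.
move=> lA sAV EA neE.
have [M /maxsetP[]/= + maxM sEM] := maxset_exists (P := mem (A :\ V)) (C := E)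
  ltac:(by rewrite /= !inE neE).
rewrite !inE => /andP[neM MA].
pose B := [set F | maxset (mem (A :\ V)) F].
have BP F : F \in B -> [/\ F \in A, F != V & forall H, H \in A -> H != V -> F \subset H -> H = F].
  rewrite inE => /maxsetP[]/=; rewrite !inE => /andP[neF FA] maxF; split=> // H HA neH.
  by apply: maxF; rewrite /= !inE neH.
have toB H : H \in A -> H != V -> exists2 F, F \in B & H \subset F.
  move=> HA neH; have [F maxF sHF] := maxset_exists (P := mem (A :\ V)) (C := H)
    ltac:(by rewrite /= !inE neH).
  by exists F; rewrite ?inE.
have MB : M \in B by rewrite inE; apply/maxsetP; split; rewrite /= ?inE ?neM.
(* If [M] is the only maximal member besides [V], a vertex of [V :\: M] lies in no member other than
   [V]. *)
have [eB|neB] := eqVneq B [set M].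
  have : V :\: M != set0.
    by apply: contra neM; rewrite setD_eq0 eqEsubset (sAV M MA) => ->.
  case/set0Pn=> v vVM; exists v => [|F H FA HA vF vH].
    by apply: subsetP vVM; apply: setDS.
  have [eF|neF] := eqVneq F V; first by rewrite eF (sAV H HA) orbT.
  have [F' + sF'] := toB F FA neF; rewrite eB inE => /eqP eF'.
  by move: vVM; rewrite inE -eF' (subsetP sF' _ vF).
have lB : leafy B by apply: leafy_subset lA; apply/subsetP => F /BP[].
have [L [G [LB neL [GB neG jG]]]] := leafy_leaf_neq lB MB neB.
have [LA neLV maxL] := BP L LB; have [GA neGV _] := BP G GB.
have visible v H : v \in L :\: G -> H \in A -> H != V -> v \in H -> H \subset L.
  rewrite inE => /andP[vG vL] HA neH vH; have [F FB sHF] := toB H HA neH.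
  have [<- //|neF] := eqVneq F L; case/negP: vG.
  have := subsetP (jG F FB neF) v; rewrite !inE vL (subsetP sHF _ vH) => /(_ isT).
  by case/andP.
pose A' := [set F :&: L | F in G |: [set H in A | H \subset L]].
have [|||||v vLG simple_v] := IHk A' L (G :&: L).
- by apply: leq_trans leVk; apply: proper_card; rewrite properEneq neLV sAV.
- apply: leafy_trace; apply: leafy_subset lA; apply/subsetP => F.
  by rewrite !inE => /orP[/eqP->|/andP[]].
- by move=> _ /imsetP[F _ ->]; apply: subsetIr.
- by apply: imset_f; rewrite !inE eqxx.
- apply: contraNneq neG => eL.
  by rewrite (maxL G) // -eL subsetIl.
have {}vLG : v \in L :\: G.
  by move: vLG; rewrite !inE; case: (v \in L); rewrite ?andbF ?andbT.
have [vG vL] := setDP vLG.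
(* [v] avoids [E]: otherwise it would lie in [L :&: M], hence in the joint [G] of [L]. *)
exists v => [|F H FA HA vF vH].
  rewrite inE (subsetP (sAV L LA)) // andbT; apply: contra vL => vE.
  have := subsetP (jG M MB _) v; rewrite eq_sym !inE vG (subsetP sEM _ vE).
  by move=> /(_ neL isT).
have [->|neF] := eqVneq F V; first by rewrite (sAV H HA) orbT.
have [->|neH] := eqVneq H V; first by rewrite (sAV F FA).
have sF := visible v F vLG FA neF vF; have sH := visible v H vLG HA neH vH.
rewrite -{1 2}(setIidPl sF) -{1 2}(setIidPl sH).
by apply: simple_v; rewrite ?(setIidPl sF) ?(setIidPl sH) //; apply/imsetP;
  [exists F | exists H]; rewrite ?(setIidPl sF) ?(setIidPl sH) // !inE ?FA ?HA ?sF ?sH orbT.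
Qed.

(** The chain condition in negative form: [a] and [b] would witness that two members through [l]
    have incomparable traces on the vertices beyond [l]. *)
Definition elimination_order (rk : 'I_n -> nat) A : Prop :=
  forall F H l a b, F \in A -> H \in A -> l \in F -> l \in H ->
    rk l < rk a -> rk l < rk b -> a \in F :\: H -> b \in H :\: F -> False.

(** A vertex whose members form a chain on [V] is put first, and the others are ordered by recursion
    on [V] without it; deleting it does not affect what lies beyond later vertices. *)
Lemma elimination_seq A V : leafy A ->
  exists2 s : seq 'I_n, uniq s /\ s =i V & elimination_order (index^~ s) [set F :&: V | F in A].
Proof.
have [k] := ubnP #|V|; elim: k => // k IHk in V *; rewrite ltnS => leVk lA.
have [->|V0] := eqVneq V set0.
  exists [::]; first by split=> // i; rewrite inE.
  by move=> F H l a b /imsetP[F' _ ->] _; rewrite setI0 inE.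
(* The empty set is adjoined to play the part of the member [E] to be avoided; it differs from [V],
   which is non-empty here. *)
have [||||v] := @leafy_simple_vertex (set0 |: [set F :&: V | F in A]) V set0.
- by apply: leafy_set0; apply: leafy_trace.
- move=> F; rewrite !inE => /orP[/eqP->|/imsetP[H _ ->]]; [exact: sub0set|exact: subsetIr].
- by rewrite !inE eqxx.
- by rewrite eq_sym.
rewrite setD0 => vV simple_v.
have [||s [Us sV] elim_s] := IHk (V :\ v) => //.
  by rewrite (cardsD1 v V) vV in leVk.
exists (v :: s); first split.
- by rewrite /= Us sV !inE eqxx.
- by move=> i; rewrite !inE sV !inE; case: eqP => [->|].
move=> _ _ l a b /imsetP[F FA ->] /imsetP[H HA ->] lF lH lta ltb aFH bFH.
have [el|nel] := eqVneq l v.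
  have /orP[] : (F :&: V \subset H :&: V) || (H :&: V \subset F :&: V).
  - apply: simple_v; rewrite -?el // !inE; apply/orP; right; apply/imsetP; by [exists F|exists H].
  - move=> sub; have /setDP[/(subsetP sub) aH] := aFH; by rewrite aH.
  - move=> sub; have /setDP[/(subsetP sub) bF] := bFH; by rewrite bF.
have nev x : index l (v :: s) < index x (v :: s) -> x != v.
  by move=> ltx; apply: contraTneq ltx => -> /=; rewrite eqxx ltn0.
have [neav nebv] := (nev a lta, nev b ltb).
have /= := elim_s (F :&: (V :\ v)) (H :&: (V :\ v)) l a b.
move: lta ltb lF lH aFH bFH; rewrite /= !inE ![v == _]eq_sym (negPf nel) (negPf neav) (negPf nebv) /=.
by rewrite !ltnS => ? ? ? ? ? ?; apply=> //; apply/imsetP; by [exists F|exists H].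
Qed.

Lemma leafy_elimination_order A : leafy A ->
  exists2 rk, injective rk & elimination_order rk A.
Proof.
move=> lA; have [s [Us sV] elim_s] := elimination_seq [set: 'I_n] lA.
exists (index^~ s) => [i j eij|].
  by rewrite -(nth_index i (s := s) (x := i)) ?sV ?inE // eij nth_index // sV inE.
move=> F H l a b FA HA; rewrite -(setIT F) -(setIT H); apply: elim_s; exact: imset_f.
Qed.

Lemma simplicial_tree_leafy D : simplicial_tree D -> leafy (facets D).
Proof.
case=> _ _ _ leafD B sB B0.
(* The complex generated by [B]. Facets of [D] are incomparable, so the facets of [E] are exactly
   the members of [B]. *)
pose E := [set G : {set 'I_n} | [exists F in B, G \subset F]].
have EP G : reflect (exists2 F, F \in B & G \subset F) (G \in E).
  by rewrite inE; apply: exists_inP.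
have facetsE : facets E = B.
  apply/setP => F; rewrite inE; apply/maxsetP/idP => /= [[/EP[H HB sFH] maxF]|FB].
    by rewrite -(maxF H) //=; apply/EP; exists H.
  split=> [|G /EP[H HB sGH] sFG]; first by apply/EP; exists F.
  have := subsetP sB F FB; rewrite inE => /maxsetP[_ maxF].
  have eH : H = F.
    apply: maxF; last exact: subset_trans sGH.
    by have := subsetP sB H HB; rewrite inE => /maxsetP[].
  by apply/eqP; rewrite eqEsubset sFG andbT -eH.
have [||F []] := leafD E; rewrite ?facetsE //.
  split; last by rewrite facetsE.
  by move=> F G /EP[H HB sFH] sGF; apply/EP; exists H => //; apply: subset_trans sFH.
by move=> FB leafF; exists F.
Qed.

End LeafyFamilies.

(** * Covers and the exchange property *)

Section Covers.
Context {n : nat}.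
Implicit Types (F G H : {set 'I_n}) (A : {set {set 'I_n}}) (m u v w : 'X_{1..n}).
Implicit Types (c : {set 'I_n} -> nat).

Definition weight F m : nat := \sum_(i in F) m i.

Lemma weightD F u v : weight F (u + v)%MM = weight F u + weight F v.
Proof. by rewrite -big_split; apply: eq_bigr => i _; rewrite mnmDE. Qed.

Lemma weight0 F : weight F 0%MM = 0.
Proof. by apply: big1 => i _; rewrite mnm0E. Qed.

Lemma weightU F l : weight F U_(l)%MM = (l \in F).
Proof.
rewrite /weight big_mkcond (bigD1 l) //= mnm1E eqxx big1 ?addn0; first by case: ifP.
by move=> i ne; rewrite mnm1E eq_sym (negPf ne); case: ifP.
Qed.

Lemma weight_subU F l m : 0 < m l -> weight F (m - U_(l))%MM + (l \in F) = weight F m.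
Proof. by move=> ml; rewrite -weightU -weightD submK // lep1mP -lt0n. Qed.

Lemma weight_le F u v : (u <= v)%MM -> weight F u <= weight F v.
Proof. by move/mnm_lepP=> le; apply: leq_sum. Qed.

Lemma weight_leS F H m :
  (forall i, i \in F -> 0 < m i -> i \in H) -> weight F m <= weight H m.
Proof.
move=> sub; rewrite /weight big_mkcond [leqRHS]big_mkcond; apply: leq_sum => i _ /=.
case: ifP => // iF; have [->|mi] := posnP (m i); first by rewrite if_same.
by rewrite (sub i iF mi).
Qed.

Lemma weightT m : weight [set: 'I_n] m = mdeg m.
Proof. by rewrite mdegE; apply: eq_bigl => i; rewrite inE. Qed.

Lemma mdeg_subU l m : 0 < m l -> (mdeg (m - U_(l))%MM).+1 = mdeg m.
Proof. by move=> ml; rewrite -!weightT -(weight_subU setT ml) inE addn1. Qed.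

Lemma mdeg_lt i u v : (u <= v)%MM -> u i < v i -> mdeg u < mdeg v.
Proof.
move=> /mnm_lepP le lt; rewrite !mdegE (bigD1 i) //= [ltnRHS](bigD1 i) //= -addSn.
by rewrite leq_add // leq_sum.
Qed.

(** The bound is a function on all subsets, the value 0 imposing nothing; thus one notion serves for
    the facets and for a bound on the degree. *)
Definition covers c m : bool := [forall F, c F <= weight F m].

Lemma coversP c m : reflect (forall F, c F <= weight F m) (covers c m).
Proof. exact: forallP. Qed.

Lemma covers_le c u v : (u <= v)%MM -> covers c u -> covers c v.
Proof.
by move=> le /coversP cu; apply/coversP => F; apply: leq_trans (cu F) (weight_le F le).
Qed.

Lemma elimination_chain rk A l F H : elimination_order rk A ->
    F \in A -> H \in A -> l \in F -> l \in H ->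
  (forall i, rk l < rk i -> i \in F -> i \in H) \/
  (forall i, rk l < rk i -> i \in H -> i \in F).
Proof.
move=> elimA FA HA lF lH.
have [/existsP[a /andP[lta aFH]]|/existsPn none] :=
  boolP [exists a, (rk l < rk a) && (a \in F :\: H)].
- right=> b ltb bH; apply: contraT => nbF; case: (elimA F H l a b) => //.
  by rewrite inE nbF.
- left=> a lta aF; apply: contraT => naH; have := none a.
  by rewrite lta inE naH aF.
Qed.

(* Think of colouring the multiset [u] with k + 1 colours so that every member
   sees as many colours as its weight allows: [a] is the first colour class and
   [b] gathers the k other ones. *)
Lemma cover_split rk A k u : injective rk -> elimination_order rk A ->
  exists a b, u = (a + b)%MM /\
    forall F, F \in A -> (weight F u <= k.+1 -> weight F a <= 1) /\
      (k.+1 <= weight F u -> 0 < weight F a /\ k <= weight F b).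
Proof.
move=> rkI elimA; have [d] := ubnP (mdeg u); elim: d => // d IHd in u *.
rewrite ltnS => led; have [->|u0] := eqVneq u 0%MM.
  by exists 0%MM, 0%MM; rewrite addm0; split=> // F _; rewrite !weight0.
have [l0 ul0] : exists l, 0 < u l.
  apply/existsP; apply: contraR u0 => /existsPn none; apply/eqP/mnmP => i.
  by rewrite mnm0E; apply/eqP; rewrite -leqn0 leqNgt none.
(* The variable to be coloured last is the first one of [u] in the elimination order, so that the
   rest of [u] lives at or beyond [l], where members through [l] form a chain. *)
case: (@arg_minnP _ l0 (fun l => 0 < u l) rk ul0) => l ul minl.
have [|a [b [eu' split_u']]] := IHd (u - U_(l))%MM; first by rewrite mdeg_subU.
have above i : 0 < (a + b)%MM i -> i = l \/ rk l < rk i.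
  rewrite -eu' mnmBE => pos; have := minl i ltac:(lia); rewrite leq_eqVlt.
  by case/orP=> [/eqP/rkI|]; [left|right].
have eu : u = (a + b + U_(l))%MM by rewrite -eu' submK // lep1mP -lt0n.
(* The inclusion beyond [l] is the same for both colour classes, so [a] and [b] order two members
   through [l] in the same direction. *)
have cmp F H : F \in A -> H \in A -> l \in F -> l \in H ->
    (weight F a <= weight H a /\ weight F b <= weight H b) \/
    (weight H a <= weight F a /\ weight H b <= weight F b).
  move=> FA HA lF lH.
  have [sub|sub] := elimination_chain elimA FA HA lF lH; [left|right];
    split; apply: weight_leS => i iF pos; case: (above i); rewrite ?mnmDE;
    try lia; try (by move=> ->); by move=> lti; apply: sub.
have wu F : weight F u = weight F a + weight F b + (l \in F).
  by rewrite eu !weightD weightU.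
have {}split_u' F : F \in A ->
  (weight F a + weight F b <= k.+1 -> weight F a <= 1) /\
  (k.+1 <= weight F a + weight F b -> 0 < weight F a /\ k <= weight F b).
  by rewrite -weightD -eu'; apply: split_u'.
(* Either colour of [l] is harmless for members avoiding [l] and for those that already have weight
   at least k + 1. *)
have out F : F \in A -> l \notin F \/ k < weight F a + weight F b ->
  forall a' b', weight F a <= weight F a' -> weight F b <= weight F b' ->
  weight F a' + weight F b' = weight F u -> (l \notin F -> weight F a' = weight F a) ->
  (weight F u <= k.+1 -> weight F a' <= 1) /\
  (k.+1 <= weight F u -> 0 < weight F a' /\ k <= weight F b').
  move=> FA lF a' b' lea leb; rewrite wu => e1 e2; have [s1 s2] := split_u' F FA.
  case: (boolP (l \in F)) lF e1 e2 => [_ [//|gt]|_ _] /= e1 e2; first by lia.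
  by have := e2 isT; lia.
have [/existsP[F0 F0P]|/existsPn none] :=
  boolP [exists F, [&& F \in A, l \in F & weight F a + weight F b <= k]]; last first.
  exists a, (b + U_(l))%MM; split=> [|F FA]; first by rewrite eu addmA.
  apply: out => //; rewrite ?weightD ?leq_addr //; last by rewrite wu weightU addnA.
  by have := none F; rewrite FA /= negb_and -ltnNge => /orP.
case: (@arg_maxnP _ F0 (fun F => [&& F \in A, l \in F & weight F a + weight F b <= k])
  (fun F => weight F a + weight F b) F0P) => M /and3P[MA lM leM] maxM.
have top F : F \in A -> l \in F -> weight F a + weight F b <= k ->
    weight F a <= weight M a /\ weight F b <= weight M b.
  move=> FA lF leF; have := maxM F; rewrite FA lF leF => /(_ isT).
  by case: (cmp F M FA MA lF lM); lia.
have [M1 M2] := split_u' M MA.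
(* [M] dominates, for both classes, every member through [l] of weight at most k so far. If it lacks
   the first colour, all of these do, and [l] receives it; otherwise [l] goes to [b], and a member
   that now reaches weight k + 1 has the same weights as [M]. *)
have [a0|a1] := posnP (weight M a).
  exists (a + U_(l))%MM, b; split=> [|F FA].
    by rewrite eu -addmA [(b + _)%MM]addmC addmA.
  have [lF|lF] := boolP (l \in F); last first.
    by apply: (out F FA (or_introl lF)); rewrite ?wu ?weightD ?weightU ?(negPf lF); lia.
  have [leF|gtF] := leqP (weight F a + weight F b) k; last first.
    by apply: (out F FA (or_intror gtF)); rewrite ?wu ?weightD ?weightU ?lF; lia.
  have := top F FA lF leF; have := split_u' F FA.
  by rewrite wu weightD weightU lF; lia.
exists a, (b + U_(l))%MM; split=> [|F FA]; first by rewrite eu addmA.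
have [lF|lF] := boolP (l \in F); last first.
  by apply: (out F FA (or_introl lF)); rewrite ?wu ?weightD ?weightU ?(negPf lF); lia.
have [leF|gtF] := leqP (weight F a + weight F b) k; last first.
  by apply: (out F FA (or_intror gtF)); rewrite ?wu ?weightD ?weightU ?lF; lia.
have := top F FA lF leF; have := split_u' F FA; have := maxM F; rewrite FA lF leF => /(_ isT).
by rewrite wu weightD weightU lF; lia.
Qed.

(** * Exchange of variables between covers *)

Section Exchange.
Variables (c : {set 'I_n} -> nat) (rk : 'I_n -> nat).
Hypothesis rkI : injective rk.
Hypothesis elim_c : elimination_order rk [set F | 0 < c F].

(** Removing [l] breaks only constraints that are tight at [u] and contain [l]. A vertex [p] beyond
    [l] common to all of them repairs the cover, and comparing the weights of [u] and [v] on the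
    smallest of these sets gives such a [p] with [u p < v p]. *)
Lemma cover_swap u v l : covers c u -> covers c v -> v l < u l ->
    (forall j, rk j < rk l -> u j = v j) -> ~~ covers c (u - U_(l))%MM ->
  exists p, [/\ rk l < rk p, u p < v p & covers c (u - U_(l) + U_(p))%MM].
Proof.
move=> /coversP cu /coversP cv ltl below.
have ul : 0 < u l by apply: leq_ltn_trans ltl.
have wt F : weight F (u - U_(l))%MM + (l \in F) = weight F u by apply: weight_subU.
pose tight F := [&& l \in F, weight F u == c F & 0 < c F].
have tightP F : weight F (u - U_(l))%MM < c F -> tight F.
  move=> lt; rewrite /tight; have := wt F; have := cu F.
  by case: (l \in F) => /=; rewrite ?addn0 ?addn1 => le e; [apply/andP; split; lia|lia].
rewrite negb_forall => /existsP[F0]; rewrite -ltnNge => /tightP tight0.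
(* By the chain condition, a tight set with the fewest vertices beyond [l] has them in common with
   every tight set. *)
case: (arg_minnP (fun F => #|[set i in F | rk l < rk i]|) tight0) => F tightF minF.
have /and3P[lF /eqP wF cF] := tightF.
have sub H : tight H -> forall i, rk l < rk i -> i \in F -> i \in H.
  move=> tightH; have /and3P[lH _ cH] := tightH.
  have [||//|sub i lti iF] := elimination_chain elim_c _ _ lF lH; rewrite ?inE //.
  have sHF : [set i in H | rk l < rk i] \subset [set i in F | rk l < rk i].
    by apply/subsetP => j; rewrite !inE => /andP[jH ltj]; rewrite ltj sub.
  have /eqP eHF : [set i in H | rk l < rk i] == [set i in F | rk l < rk i].
    by rewrite eqEcard sHF minF.
  by have /setP/(_ i) := eHF; rewrite !inE iF lti andbT.
have [/existsP[p /andP[pF ltp]]|/existsPn none] := boolP [exists p in F, u p < v p].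
  have ltlp : rk l < rk p.
    rewrite ltnNge leq_eqVlt negb_or; apply/andP; split.
      by apply: contraTneq ltp => /rkI->; rewrite -leqNgt ltnW.
    by apply: contraTN ltp => /below->; rewrite ltnn.
  exists p; split=> //; apply/coversP => H; rewrite weightD weightU leqNgt.
  apply/negP => lt; have tightH : tight H by apply: tightP; lia.
  have pH := sub H tightH p ltlp pF; have := cu H; have := wt H; move: lt.
  by rewrite pH; case: (l \in H); lia.
have : weight F v < weight F u.
  rewrite /weight (bigD1 l) //= [ltnRHS](bigD1 l) //= -addSn leq_add //.
  by apply: leq_sum => i /andP[iF _]; have := none i; rewrite iF -leqNgt.
by rewrite wF ltnNge cv.
Qed.

(** Testing unit decrements suffices for minimality under divisibility, since covers are closed
    upwards. *)
Definition minimal_cover m : bool :=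
  covers c m && [forall l, (0 < m l) ==> ~~ covers c (m - U_(l))%MM].

Lemma minimal_coverP m : reflect (covers c m /\
  forall l, 0 < m l -> ~~ covers c (m - U_(l))%MM) (minimal_cover m).
Proof.
apply: (iffP andP) => -[cm] => [/forallP minm|minm]; split=> //.
  by move=> l ml; have := minm l; rewrite ml.
by apply/forallP => l; apply/implyP; apply: minm.
Qed.

Lemma minimal_cover_exists m : covers c m -> exists2 w, minimal_cover w & (w <= m)%MM.
Proof.
have [d] := ubnP (mdeg m); elim: d => // d IHd in m *; rewrite ltnS => led cm.
have [minm|nmin] := boolP (minimal_cover m); first by exists m; rewrite ?lepm_refl.
move: nmin; rewrite /minimal_cover cm /= negb_forall => /existsP[l].
rewrite negb_imply negbK => /andP[ml cml].
have [|w minw lew] := IHd _ _ cml; first by rewrite mdeg_subU.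
by exists w => //; apply: lepm_trans lew (lem_subr _ _).
Qed.

Lemma minimal_cover_antichain u v :
  covers c u -> minimal_cover v -> (u <= v)%MM -> u = v.
Proof.
move=> cu /minimal_coverP[_ minv] /mnm_lepP le; apply/mnmP => i; apply/eqP.
rewrite eqn_leq le leqNgt; apply/negP => lt.
have /negP[] := minv i ltac:(exact: leq_ltn_trans lt).
apply: covers_le cu; apply/mnm_lepP => j; rewrite mnmBE mnm1E.
by have := le j; case: eqP => [<-|_]; lia.
Qed.

(* Degree first, then lexicographic with the vertices eliminated last being
   compared first and large exponents coming first. *)
Definition lex_before u v : bool :=
  [exists i, (v i < u i) && [forall j, (rk i < rk j) ==> (u j == v j)]].

Definition cover_before u v : bool :=
  (mdeg u < mdeg v) || ((mdeg u == mdeg v) && lex_before u v).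

Lemma lex_beforeP u v : reflect
  (exists2 i, v i < u i & forall j, rk i < rk j -> u j = v j) (lex_before u v).
Proof.
apply: (iffP existsP) => [[i /andP[lt /forallP eq]]|[i lt eq]]; exists i => //.
  by move=> j ltj; apply/eqP; have := eq j; rewrite ltj.
by rewrite lt; apply/forallP => j; apply/implyP => /eq/eqP.
Qed.

Lemma lex_before_total u v : u != v -> lex_before u v || lex_before v u.
Proof.
move=> neq.
have [i0 ne0] : exists i, u i != v i.
  by apply/existsP; apply: contraR neq => /existsPn e; apply/eqP/mnmP => i; apply/eqP/negPn.
case: (@arg_maxnP _ i0 (fun i => u i != v i) rk ne0) => i ne maxi.
have eq j : rk i < rk j -> u j = v j.
  by rewrite ltnNge => nle; apply/eqP; apply: contraNT nle; apply: maxi.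
case: (ltngtP (u i) (v i)) ne => // lt _; apply/orP; [right|left]; apply/lex_beforeP; exists i => //.
by move=> j /eq->.
Qed.

Lemma lex_before_trans : transitive lex_before.
Proof.
move=> v u w /lex_beforeP[i lti eqi] /lex_beforeP[j ltj eqj]; apply/lex_beforeP.
have [ltij|ltji|/rkI eij] := ltngtP (rk i) (rk j).
- by exists j => [|k ltk]; [rewrite eqi|rewrite eqi ?eqj //; apply: ltn_trans ltk].
- by exists i => [|k ltk]; [rewrite -eqj|rewrite eqi ?eqj //; apply: ltn_trans ltk].
- exists i => [|k ltk]; first by apply: leq_ltn_trans lti; rewrite eij ltnW.
  by rewrite eqi // eqj // -eij.
Qed.

Lemma lex_before_irr u : ~~ lex_before u u.
Proof. by apply/lex_beforeP => -[i]; rewrite ltnn. Qed.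

Lemma cover_before_trans : transitive cover_before.
Proof.
move=> v u w; rewrite /cover_before => /orP[lt1|/andP[/eqP-> lex1]] /orP[lt2|/andP[/eqP<- lex2]].
- by rewrite (ltn_trans lt1 lt2).
- by rewrite lt1.
- by rewrite lt2.
- by rewrite eqxx (lex_before_trans lex1 lex2) orbT.
Qed.

Lemma cover_before_irr u : ~~ cover_before u u.
Proof. by rewrite /cover_before ltnn eqxx lex_before_irr. Qed.

Lemma cover_before_total u v : u != v -> cover_before u v || cover_before v u.
Proof.
move=> /lex_before_total; rewrite /cover_before [mdeg v == _]eq_sym.
by case: ltngtP.
Qed.

(** This provides the variable [p] of the colon ideal at [v] attached to the earlier [u]. At the
    first vertex [i] where they differ, [cover_swap] applies to [v] if [u i < v i]. Otherwise [u] is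
    moved towards [v], by lowering it at [i] or by swapping [i] for a later vertex, until the first
    case occurs. *)
Lemma cover_exchange u v : covers c u -> minimal_cover v -> cover_before u v ->
  exists l p, [/\ rk l < rk p, v p < u p, 0 < v l & covers c (v - U_(l) + U_(p))%MM].
Proof.
move=> cu minv; have [d] := ubnP (mdeg (u - v)%MM); elim: d => // d IHd in u cu *.
have [cv mincv] := minimal_coverP _ minv.
rewrite ltnS => led before_uv; have neq : u != v.
  by apply: contraTneq before_uv => ->; apply: cover_before_irr.
have [i0 ne0] : exists i, u i != v i.
  by apply/existsP; apply: contraR neq => /existsPn e; apply/eqP/mnmP => i; apply/eqP/negPn.
case: (@arg_minnP _ i0 (fun i => u i != v i) rk ne0) => i ne mini.
have below j : rk j < rk i -> u j = v j.
  by rewrite ltnNge => nle; apply/eqP; apply: contraNT nle; apply: mini.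
case: (ltngtP (u i) (v i)) ne => // lti _.
  have [j ltj||p [ltp ltvp cp]] := cover_swap cv cu lti.
  - by rewrite below.
  - by apply: mincv; apply: leq_ltn_trans lti.
  by exists i, p; split=> //; apply: leq_ltn_trans lti.
have lt0 : 0 < u i by apply: leq_ltn_trans lti.
have [cu'|ncu'] := boolP (covers c (u - U_(i))%MM).
  have [||l [p [ltlp ltp vl cp]]] := IHd _ cu'.
  - apply: leq_trans led; apply: (mdeg_lt (i := i)).
      by apply/mnm_lepP => j; rewrite !mnmBE mnm1E; lia.
    by rewrite !mnmBE mnm1E eqxx; lia.
  - rewrite /cover_before; have := mdeg_subU lt0; move: before_uv; rewrite /cover_before.
    by case/orP=> [lt|/andP[/eqP eq _]]; lia.
  - exists l, p; split=> //; apply: leq_trans ltp _; rewrite mnmBE; exact: leq_subr.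
have [p [ltip ltup cu']] := cover_swap cu cv lti below ncu'.
have eu' j : (u - U_(i) + U_(p))%MM j = u j - (i == j) + (p == j).
  by rewrite mnmDE mnmBE !mnm1E.
have nip : i != p by apply: contraTneq ltip => ->; rewrite ltnn.
have [||l [p' [ltlp' ltp' vl cp']]] := IHd _ cu'.
- apply: leq_trans led; apply: (mdeg_lt (i := i)).
    by apply/mnm_lepP => j; rewrite !mnmBE eu'; case: eqP => [<-|_]; case: eqP => [<-|_]; lia.
  by rewrite !mnmBE eu' eqxx eq_sym (negPf nip); lia.
- have mdeg_u' : mdeg (u - U_(i) + U_(p))%MM = mdeg u.
    by rewrite mdegD mdeg1 addn1 mdeg_subU.
  rewrite /cover_before mdeg_u'; case/orP: before_uv => [->//|/andP[/eqP-> /lex_beforeP[t ltt eqt]]].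
  rewrite ltnn eqxx /=; apply/lex_beforeP.
  (* [u] exceeds [v] at [t] and agrees with it beyond, but is smaller at [p]; so the swap takes
     place below [t] and leaves the lexicographic comparison unchanged. *)
  have ltpt : rk p < rk t.
    rewrite ltnNge leq_eqVlt negb_or; apply/andP; split.
      by apply: contraTneq ltt => /rkI->; rewrite -leqNgt ltnW.
    by apply: contraTN ltup => /eqt->; rewrite ltnn.
  have off j : rk p < rk j -> (u - U_(i) + U_(p))%MM j = u j.
    move=> ltj; rewrite eu'.
    have [/negPf-> /negPf->] : i != j /\ p != j; last by rewrite subn0 addn0.
    split; apply: contraTneq ltj => <-; rewrite -leqNgt // ltnW //.
  exists t => [|j ltj]; first by rewrite off.
  by rewrite off ?eqt //; apply: ltn_trans ltj.
- exists l, p'; split=> //; move: ltp'; rewrite eu'.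
  by case: eqP => [<-|_]; case: eqP => [<-|_]; lia.
Qed.

End Exchange.
End Covers.

(** * Monomial ideals *)

Import GRing.Theory.

Section MonomialIdeals.
Context {n : nat} {K : fieldType}.
Local Notation S := {mpoly K[n]}.
Implicit Types (m u v w : 'X_{1..n}) (P Q : 'X_{1..n} -> Prop) (I J G : S -> Prop) (f g : S).
Local Open Scope ring_scope.

(** The span of the monomials in [P], an ideal when [P] is [upward] and closed under taking terms by
    construction; the ideals of the statement are compared in this form. *)
Definition mon_ideal P : S -> Prop := fun f => forall m, m \in msupp f -> P m.

Definition upward P : Prop := forall u v, (u <= v)%MM -> P u -> P v.

Lemma mon_ideal0 P : mon_ideal P 0.
Proof. by move=> m; rewrite msupp0. Qed.

Lemma mon_idealD P f g : mon_ideal P f -> mon_ideal P g -> mon_ideal P (f + g).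
Proof. by move=> Pf Pg m /msuppD_le; rewrite mem_cat => /orP[/Pf|/Pg]. Qed.

Lemma mon_idealN P f : mon_ideal P f -> mon_ideal P (- f).
Proof. by move=> Pf m; rewrite (perm_mem (msuppN f)) => /Pf. Qed.

Lemma mon_ideal_sum P (T : eqType) (r : seq T) (F : T -> S) :
  (forall i, i \in r -> mon_ideal P (F i)) -> mon_ideal P (\sum_(i <- r) F i).
Proof.
move=> PF; rewrite big_seq; apply: big_ind => //; [exact: mon_ideal0 | exact: mon_idealD].
Qed.

Lemma mon_idealM P Q (R : 'X_{1..n} -> Prop) f g :
  (forall u v, P u -> Q v -> R (u + v)%MM) ->
  mon_ideal P f -> mon_ideal Q g -> mon_ideal R (f * g).
Proof. by move=> PQR Pf Qg m /msuppM_le/allpairsP[[u v] /= [/Pf Pu /Qg Qv ->]]; apply: PQR. Qed.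

Lemma mon_ideal_mull P f g : upward P -> mon_ideal P g -> mon_ideal P (f * g).
Proof.
move=> upP Pg; apply: (@mon_idealM (fun _ => True) P) => // u v _; apply: upP; exact: lem_addl.
Qed.

(** A polynomial is the sum of its terms, and each term is a multiple of a monomial generator. *)
Lemma ideal_gen_mon G P : upward P -> (forall g, G g -> mon_ideal P g) ->
    (forall m, P m -> exists2 u, (u <= m)%MM & G 'X_[u]) ->
  same_ideal (ideal_gen G) (mon_ideal P).
Proof.
move=> upP GP PG f; split=> [[s [Gs ->]]|Pf].
  by apply: mon_ideal_sum => p /Gs/GP; apply: mon_ideal_mull.
rewrite (mpolyE f) big_seq; apply: big_ind.
- by exists [::]; rewrite big_nil.
- by move=> _ _ [s [Gs ->]] [t [Gt ->]]; exists (s ++ t); rewrite big_cat; split=> // p;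
    rewrite mem_cat => /orP[/Gs|/Gt].
move=> m /Pf/PG[u leu Gu]; exists [:: (f@_m *: 'X_[m - u], 'X_[u])].
split=> [p|]; first by rewrite inE => /eqP->.
by rewrite big_seq1 -scalerAl -mpolyXD submK.
Qed.

Lemma mon_idealX P m : mon_ideal P 'X_[m] <-> P m.
Proof. by split=> [|Pm u]; [apply; rewrite msuppX inE | rewrite msuppX inE => /eqP->]. Qed.

Definition above (s : seq 'X_{1..n}) m : Prop := exists2 u, u \in s & (u <= m)%MM.

Lemma above_upward s : upward (above s).
Proof. by move=> u v leuv [w ws le]; exists w => //; apply: lepm_trans leuv. Qed.

Lemma monomial_ideal_genE s : same_ideal (monomial_ideal_gen s) (mon_ideal (above s)).
Proof.
apply: ideal_gen_mon; first exact: above_upward.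
- by move=> _ [m ms ->]; apply/mon_idealX; exists m; rewrite ?lepm_refl.
- by move=> m [u us le]; exists u => //; exists u.
Qed.

Definition meets (A : {set 'I_n}) m : Prop := exists2 j, j \in A & (0 < m j)%N.

Lemma meets_upward A : upward (meets A).
Proof. by move=> u v /mnm_lepP le [j jA uj]; exists j => //; apply: leq_trans uj (le j). Qed.

Lemma var_idealE A : same_ideal (@var_ideal n K A) (mon_ideal (meets A)).
Proof.
apply: ideal_gen_mon; first exact: meets_upward.
- by move=> _ [j jA ->]; apply/mon_idealX; exists j => //; rewrite mnm1E eqxx.
- by move=> m [j jA mj]; exists U_(j)%MM; [rewrite lep1mP -lt0n | exists j].
Qed.

(** Multiplication by a monomial shifts the support without cancellation, so membership in the colon
    is decided term by term. *)
Lemma monomial_colonE s v :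
  same_ideal (ideal_colon (monomial_ideal_gen s) (monomial_ideal_gen [:: v]))
             (@mon_ideal (fun m => above s (m + v)%MM)).
Proof.
move=> f; split=> [colonf m mf|af g /monomial_ideal_genE vg].
  have /monomial_ideal_genE : monomial_ideal_gen s (f * 'X_[v]).
    by apply/colonf/monomial_ideal_genE/mon_idealX; exists v; rewrite ?inE ?lepm_refl.
  by apply; rewrite mcoeff_msupp addmC mcoeffMX -mcoeff_msupp.
apply/monomial_ideal_genE; apply: mon_idealM af vg => u w au [v']; rewrite inE => /eqP-> le.
by apply: above_upward au; apply/mnm_lepP => i; rewrite !mnmDE leq_add2l; move/mnm_lepP: le.
Qed.

Lemma vertex_cover_idealE D : same_ideal (@vertex_cover_ideal n K D)
  (mon_ideal (covers (fun F => F \in facets D : nat))).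
Proof.
move=> f; split=> [If m mf|If F FD].
  apply/coversP => F; case FD: (F \in facets D) => //.
  have /var_idealE/(_ m mf)[j jF mj] := If F FD.
  by rewrite /weight (bigD1 j) //= ltn_addr.
apply/var_idealE => m /If/coversP/(_ F); rewrite FD /weight => pos.
have [/existsP[j /andP[jF mj]]|/existsPn none] := boolP [exists j in F, (0 < m j)%N].
  by exists j.
by rewrite big1 // in pos => j jF; have := none j; rewrite jF -leqNgt leqn0 => /eqP.
Qed.

Lemma mon_ideal_mul P Q (R : 'X_{1..n} -> Prop) : upward P -> upward Q -> upward R ->
    (forall u v, P u -> Q v -> R (u + v)%MM) ->
    (forall m, R m -> exists u v, [/\ P u, Q v & m = (u + v)%MM]) ->
  same_ideal (ideal_mul (mon_ideal P) (mon_ideal Q)) (mon_ideal R).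
Proof.
move=> upP upQ upR PQR RPQ; apply: ideal_gen_mon => //.
  by move=> _ [a [b [Pa Qb ->]]]; apply: mon_idealM Pa Qb.
move=> m /RPQ[u [v [Pu Qv ->]]]; exists (u + v)%MM; rewrite ?lepm_refl //.
by exists 'X_[u], 'X_[v]; rewrite mpolyXD; split=> //; apply/mon_idealX.
Qed.

Lemma ideal_mul_ext I I' J J' : same_ideal I I' -> same_ideal J J' ->
  same_ideal (ideal_mul I J) (ideal_mul I' J').
Proof.
by move=> eI eJ f; split=> -[s [Gs ->]]; exists s; split=> // p /Gs[a [b [/eI Ia /eJ Jb ->]]];
  exists a, b.
Qed.

(** Equality of ordinary and symbolic powers. Additivity of weights gives one inclusion; for the
    other, [cover_split] writes a (k+1)-cover as a 1-cover plus a k-cover. *)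
Lemma ideal_exp_vertex_coverE D k : leafy (facets D) ->
  same_ideal (ideal_exp (@vertex_cover_ideal n K D) k)
             (mon_ideal (covers (fun F => k * (F \in facets D))%N)).
Proof.
move=> /leafy_elimination_order[rk rkI elim_rk].
have up c : upward (covers c) by move=> u v; apply: covers_le.
elim: k => [|k IHk] f /=.
  by split=> // _ m _; apply/coversP.
have /(_ f) -> := ideal_mul_ext (@vertex_cover_idealE D) IHk.
apply: (mon_ideal_mul (up _) (up _) (up _)).
- move=> u v /coversP cu /coversP cv; apply/coversP => F.
  by rewrite mulSn weightD leq_add.
- move=> m /coversP cm; have [a [b [em split_m]]] := cover_split k m rkI elim_rk.
  exists a, b; split=> //; apply/coversP => F; have := cm F; case FD: (F \in facets D);
    rewrite ?muln0 ?muln1 // => le; by have [_ /(_ le)[]] := split_m F FD.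
Qed.

Lemma mon_ideal_graded P I : same_ideal I (mon_ideal P) -> graded_ideal I.
Proof.
move=> eI f /eI Pf d; apply/eI => m; rewrite pihomogE => /msupp_sum_le.
move=> /flattenP[t /mapP[u]]; rewrite mem_filter => /andP[_ uf] ->.
by move=> /msuppZ_le; rewrite msuppX inE => /eqP->; apply: Pf.
Qed.

Lemma mon_ideal_component P I (j : nat) : upward P -> same_ideal I (mon_ideal P) ->
  same_ideal (degree_component_ideal I j)
    (mon_ideal (fun m => exists u, [/\ P u, mdeg u = j & (u <= m)%MM])).
Proof.
move=> upP eI; apply: ideal_gen_mon.
- by move=> u v le [w [Pw dw lew]]; exists w; split=> //; apply: lepm_trans le.
- move=> f [/eI Pf /dhomogP homf] m mf; exists m; split; [exact: Pf|exact: homf|exact: lepm_refl].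
- move=> m [u [Pu du le]]; exists u => //; split; last by rewrite dhomogX; apply/eqP.
  by apply/eI/mon_idealX.
Qed.

End MonomialIdeals.

(** * Sorted minimal covers and linear quotients *)

Section CoverIdeals.
Context {n : nat} {K : fieldType}.
Variables (c : {set 'I_n} -> nat) (rk : 'I_n -> nat).
Hypothesis rkI : injective rk.
Hypothesis elim_c : elimination_order rk [set F | 0 < c F].
Implicit Types (m u v w : 'X_{1..n}) (e : nat).

Local Notation before := (cover_before rk).

Definition cover_le u v : bool := (u == v) || before u v.

(** The bound [e] makes the enumeration finite. As degree is compared first, it cuts off an initial
    segment, so the colon computation holds for each [e]: large values give all generators, and
    [e = j] serves for components. *)
Definition minimal_covers e : seq 'X_{1..n} :=
  sort cover_le [seq m <- map (@bmnm n e.+1) (enum {: 'X_{1..n < e.+1}}) | minimal_cover c m].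

Lemma mem_minimal_covers e m :
  (m \in minimal_covers e) = minimal_cover c m && (mdeg m <= e).
Proof.
rewrite mem_sort mem_filter; congr andb; apply/mapP/idP => [[u _ ->]|le].
  by rewrite -ltnS bmdeg.
by have lt : mdeg m < e.+1 by []; exists (BMultinom lt); rewrite ?mem_enum.
Qed.

Lemma minimal_covers_uniq e : uniq (minimal_covers e).
Proof. by rewrite sort_uniq filter_uniq // map_inj_uniq ?enum_uniq //; apply: val_inj. Qed.

Lemma minimal_covers_before e i j : i < j < size (minimal_covers e) ->
  before (nth 0%MM (minimal_covers e) i) (nth 0%MM (minimal_covers e) j).
Proof.
move=> /andP[ltij ltj]; have lti := ltn_trans ltij ltj.
have : cover_le (nth 0%MM (minimal_covers e) i) (nth 0%MM (minimal_covers e) j).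
  apply: (sorted_ltn_nth (leT := cover_le)) => //.
    move=> v u w /orP[/eqP->//|lt1] /orP[/eqP<-|lt2]; first by rewrite /cover_le lt1 orbT.
    by rewrite /cover_le (cover_before_trans rkI lt1 lt2) orbT.
  apply: sort_sorted => u v; rewrite /cover_le eq_sym; have [//|ne] := eqVneq v u.
  by rewrite eq_sym in ne; apply: cover_before_total.
by rewrite /cover_le nth_uniq ?minimal_covers_uniq // (ltn_eqF ltij).
Qed.

Lemma mem_take_minimal_covers e i w : i < size (minimal_covers e) ->
    w \in minimal_covers e ->
  (w \in take i (minimal_covers e)) = before w (nth 0%MM (minimal_covers e) i).
Proof.
move=> lti ws; rewrite in_take //; have := ws; rewrite -index_mem => ltw.
rewrite -{2}(nth_index 0%MM ws); case: ltngtP => [lt|gt|->].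
- by rewrite minimal_covers_before ?lt.
- apply/esym/negbTE; apply: contraTN (cover_before_irr rk (nth 0%MM (minimal_covers e) i)) => lt.
  rewrite negbK; apply: (cover_before_trans rkI _ lt).
  by rewrite minimal_covers_before ?gt.
- by rewrite (negPf (cover_before_irr _ _)).
Qed.

(** The set consists of the variables whose product with [v] is divisible by an earlier generator.
    For an earlier [u], the exchange gives a cover [x] dividing [v] times the variable [p], and a
    minimal cover [w] dividing [x] precedes [v]. *)
Lemma minimal_covers_colon e i : i < size (minimal_covers e) ->
  let v := nth 0%MM (minimal_covers e) i in
  same_ideal (ideal_colon (@monomial_ideal_gen n K (take i (minimal_covers e)))
                          (monomial_ideal_gen [:: v]))
    (var_ideal [set p | has (fun w => (w <= v + U_(p))%MM) (take i (minimal_covers e))]).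
Proof.
set s := minimal_covers e => lti v f.
have vs : v \in s by apply: mem_nth.
have /andP[minv lev] : minimal_cover c v && (mdeg v <= e) by rewrite -mem_minimal_covers.
apply: (iff_trans (monomial_colonE _ _ f)); apply: iff_sym.
apply: (iff_trans (var_idealE _ f)); split=> If m /If.
  case=> j; rewrite inE => /hasP[w ws lew] mj; exists w => //; apply: lepm_trans lew _.
  apply/mnm_lepP => i'; rewrite !mnmDE addnC leq_add2r mnm1E; by case: eqP => [<-|].
case=> u us leu; have us' : u \in s by apply: mem_take us.
have := us; rewrite mem_take_minimal_covers // => before_uv.
have /andP[/minimal_coverP[cu _] _] : minimal_cover c u && (mdeg u <= e).
  by rewrite -mem_minimal_covers.
have [l [p [ltlp ltp vl cx]]] := cover_exchange rkI elim_c cu minv before_uv.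
have mp : 0 < m p by have /mnm_lepP/(_ p) := leu; rewrite mnmDE; lia.
have [w minw lew] := minimal_cover_exists cx.
set x := (v - U_(l) + U_(p))%MM in cx lew.
have npl : p != l by apply: contraTneq ltlp => ->; rewrite ltnn.
have degx : mdeg x = mdeg v by rewrite mdegD mdeg1 addn1 mdeg_subU.
(* Either [w = x], which precedes [v] lexicographically because [p] ranks above [l], or [w] divides
   [x] properly and has smaller degree than [v]. *)
have before_wv : before w v.
  have [->|nex] := eqVneq w x.
    rewrite /cover_before degx ltnn eqxx; apply/lex_beforeP; exists p.
      by rewrite mnmDE mnmBE !mnm1E eqxx eq_sym (negPf npl) subn0 addn1.
    move=> j ltj; rewrite mnmDE mnmBE !mnm1E.
    have [/negPf-> /negPf->] : l != j /\ p != j; last by rewrite subn0 addn0.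
    by split; apply: contraTneq ltj => <-; rewrite -leqNgt // ltnW.
  rewrite /cover_before -degx; have [i' lti'] : exists i', w i' < x i'.
    apply/existsP; apply: contraR nex => /existsPn none; apply/eqP/mnmP => i'.
    have := none i'; rewrite -leqNgt => le; apply/eqP.
    by rewrite eqn_leq le andbT; move/mnm_lepP: lew.
  by rewrite (mdeg_lt lew lti').
have ws : w \in take i s.
  rewrite mem_take_minimal_covers // mem_minimal_covers minw (leq_trans _ lev) // -degx.
  by rewrite !mdegE leq_sum // => i' _; move/mnm_lepP: lew.
exists p => //; rewrite inE; apply/hasP; exists w => //; apply: lepm_trans lew _.
by apply/mnm_lepP => i'; rewrite !mnmDE mnmBE leq_add2r leq_subr.
Qed.

(** Finiteness of the minimal covers: lowering a positive exponent at [l] violates some [F] through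
    [l], so that this exponent is at most the weight on [F], hence at most [c F]. *)
Lemma minimal_cover_mdeg m : minimal_cover c m -> mdeg m <= n * \sum_F c F.
Proof.
move=> /minimal_coverP[/coversP cm minm].
suff le l : m l <= \sum_F c F.
  rewrite mdegE -[n in n * _]card_ord -sum_nat_const; exact: leq_sum.
have [->//|ml] := posnP (m l).
have := minm l ml; rewrite negb_forall => /existsP[F]; rewrite -ltnNge => lt.
have /= wF := weight_subU F ml; have := cm F.
have [lF|lF] := boolP (l \in F); rewrite ?lF ?(negPf lF) in wF; last by lia.
move=> _; have : m l <= weight F m by rewrite /weight (bigD1 l) //= leq_addr.
have : c F <= \sum_F c F by rewrite (bigD1 F) //= leq_addr.
by move=> leS leF; apply: leq_trans leF (leq_trans _ leS); rewrite -wF addn1.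
Qed.

Lemma minimal_covers_generate e : (forall m, minimal_cover c m -> mdeg m <= e) ->
  minimal_monomial_generators (@mon_ideal n K (covers c)) (minimal_covers e).
Proof.
move=> bound; have memE m : (m \in minimal_covers e) = minimal_cover c m.
  by rewrite mem_minimal_covers; case: (boolP (minimal_cover c m)) => // /bound->.
split; first exact: minimal_covers_uniq.
  move=> f; apply: iff_sym; apply: (iff_trans (monomial_ideal_genE _ f)).
  split=> If m /If => [[w]|/minimal_cover_exists[w minw lew]].
    by rewrite memE => /minimal_coverP[cw _] lew; apply: covers_le cw.
  by exists w; rewrite ?memE.
move=> t sub eI u; rewrite memE => minu.
have /eI/monomial_ideal_genE/mon_idealX[w wt lew] : @mon_ideal n K (covers c) 'X_[u].
  by apply/mon_idealX; have /minimal_coverP[] := minu.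
suff <- : w = u by [].
have := sub w wt; rewrite memE => /minimal_coverP[cw _]; exact: minimal_cover_antichain minu lew.
Qed.

Lemma cover_ideal_linear_quotients : linear_quotients (@mon_ideal n K (covers c)).
Proof.
exists (minimal_covers (n * \sum_F c F)); split.
  exact/minimal_covers_generate/minimal_cover_mdeg.
by move=> i lti; eexists; apply: minimal_covers_colon.
Qed.

End CoverIdeals.

(** * Linear resolutions *)

Local Open Scope ring_scope.

Section LinearResolution.
Context {n : nat} {K : fieldType}.
Local Notation S := {mpoly K[n]}.

Lemma ideal_gen_ind (G R : S -> Prop) : R 0 ->
    (forall f g, R f -> R g -> R (f + g)) -> (forall a g, G g -> R (a * g)) ->
  forall f, ideal_gen G f -> R f.
Proof.
move=> R0 RD RM _ [s [Gs ->]]; rewrite big_seq; apply: big_ind => // p /Gs; exact: RM.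
Qed.

Lemma mcoeff_pihomog d (f : S) m : (pihomog mdeg d f)@_m = f@_m *+ (mdeg m == d).
Proof.
rewrite pihomogE [f in RHS]mpolyE !raddf_sum -sumrMnl /= big_mkcond.
apply: eq_bigr => u _; rewrite mcoeffZ mcoeffX; have [->|_] := eqVneq u m.
  by case: eqP; rewrite ?mulr1n.
by rewrite mulr0 mul0rn; case: ifP.
Qed.

Lemma pihomog_mulr d e (f h : S) : h \is e.-homog ->
  pihomog mdeg (d + e) (f * h) = pihomog mdeg d f * h.
Proof.
move=> hh; apply/mpolyP => m; rewrite mcoeff_pihomog.
have [eqm|nem] := altP (mdeg m =P (d + e)%N); last first.
  have /dhomog_nemf_coeff-> // := dhomogM (pihomogP mdeg d f) hh.
rewrite mulr1n -[f in LHS](subrK (pihomog mdeg d f)) mulrDl mcoeffD -[RHS]add0r; congr (_ + _).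
apply: memN_msupp_eq0; apply/negP => /msuppM_le/allpairsP[[u v] /= [uf vh eqm']].
have /dhomogP/(_ v vh) /= dv := hh; move: uf; rewrite mcoeff_msupp mcoeffB mcoeff_pihomog.
have /eqP-> : mdeg u == d by rewrite -(eqn_add2r e) -[in X in (_ + X)%N == _]dv -mdegD -eqm' eqm.
by rewrite eqxx subrr eqxx.
Qed.

(** The coordinates, ranked by [r], filter the free module; these ideals are the successive
    quotients of the induced filtration of [N]. *)
Definition leading_ideal m (N : 'rV[S]_m -> Prop) (r : 'I_m -> nat) i : S -> Prop :=
  fun f => exists v, [/\ N v, v 0 i = f & forall j, (r i < r j)%N -> v 0 j = 0].

(** Homogeneous components are taken entrywise, that is, all basis vectors of the free module share
    one degree. *)
Definition graded_submodule m (N : 'rV[S]_m -> Prop) : Prop :=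
  [/\ N 0, forall u v, N u -> N v -> N (u + v), forall a v, N v -> N (a *: v) &
      forall d v, N v -> N (map_mx (pihomog mdeg d) v)].

(* This property passes to the first syzygies, so that iterating produces a
   linear resolution without mapping cones or Koszul complexes. *)
Definition variable_led m (N : 'rV[S]_m -> Prop) : Prop :=
  graded_submodule N /\ exists2 r : 'I_m -> nat, injective r &
    forall i, exists A, same_ideal (leading_ideal N r i) (var_ideal A).

Lemma kernel_graded_submodule p m e (A : 'M[S]_(p, m)) :
  (forall i j, A i j \is e.-homog) -> graded_submodule (fun w => w *m A = 0).
Proof.
move=> homA; split=> [|u v eu ev|a v ev|d v ev].
- exact: mul0mx.
- by rewrite mulmxDl eu ev addr0.
- by rewrite -scalemxAl ev scaler0.
- apply/rowP => j; have /rowP/(_ j) := ev; rewrite !mxE => ev_j.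
  transitivity (pihomog mdeg (d + e) (\sum_i v 0 i * A i j)); last by rewrite ev_j raddf0.
  by rewrite [RHS]raddf_sum; apply: eq_bigr => i _; rewrite mxE /= pihomog_mulr.
Qed.

Lemma ltn_lex (x y a b : nat) : (a < n -> b < n ->
  (x * n + a < y * n + b) = (x < y) || ((x == y) && (a < b)))%N.
Proof.
move=> lta ltb; case: (ltngtP x y) => [lt|lt|->] /=; last by rewrite ltn_add2l.
  by have : (x.+1 * n <= y * n)%N; [rewrite leq_mul2r lt orbT|rewrite mulSn; lia].
by have : (y.+1 * n <= x * n)%N; [rewrite leq_mul2r lt orbT|rewrite mulSn; lia].
Qed.

(** The rows of [A] are vectors with leading entry a variable, one for each leading coordinate and
    each variable of its ideal. Their syzygies inherit the property because variables have linear
    quotients: dividing the ideal of the smaller variables by the next variable gives that same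
    ideal. *)
Lemma variable_led_step m (N : 'rV[S]_m -> Prop) : variable_led N ->
  exists p (A : 'M[S]_(p, m)),
    [/\ forall k l, A k l \is 1.-homog, forall v, N v <-> exists w, v = w *m A &
        variable_led (fun w => w *m A = 0)].
Proof.
move=> [[N0 ND NZ Nhom] [r rI /fin_all_exists[V NV]]].
pose T := [set q : 'I_m * 'I_n | q.2 \in V q.1].
pose ci (q : 'I_#|T|) := (enum_val q).1; pose cv (q : 'I_#|T|) := (enum_val q).2.
have cvV q : cv q \in V (ci q) by have := enum_valP q; rewrite inE.
have cP i a : a \in V i -> exists q, ci q = i /\ cv q = a.
  move=> aV; have iaT : (i, a) \in T by rewrite inE.
  by exists (enum_rank_in iaT (i, a)); rewrite /ci /cv enum_rankK_in.
have [g gP] : exists g : 'I_#|T| -> 'rV[S]_m, forall q,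
    [/\ N (g q), g q 0 (ci q) = 'X_(cv q), forall j, (r (ci q) < r j)%N -> g q 0 j = 0 &
        forall j, g q 0 j \is 1.-homog].
  apply: (@fin_all_exists _ _ (fun q v => [/\ N v, v 0 (ci q) = 'X_(cv q),
    forall j, (r (ci q) < r j)%N -> v 0 j = 0 & forall j, v 0 j \is 1.-homog])) => q.
  have /NV[v [Nv ev upv]] : var_ideal (V (ci q)) ('X_(cv q) : S).
    by apply/var_idealE/mon_idealX; exists (cv q); rewrite ?cvV // mnm1E eqxx.
  (* Passing to the degree 1 component makes the entries linear and keeps the leading entry, which
     is a variable. *)
  exists (map_mx (pihomog mdeg 1) v); split=> [||j /upv vj|j]; rewrite ?mxE.
  - exact: Nhom.
  - by rewrite ev pihomog_dE // dhomogX /= mdeg1.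
  - by rewrite vj raddf0.
  - exact: pihomogP.
pose A := \matrix_q g q.
have Aij q j : A q j = g q 0 j by rewrite mxE.
have rowA q : row q A = g q by rewrite rowK.
have deltaA q : delta_mx 0 q *m A = g q by rewrite -rowE.
have NA w : N (w *m A).
  rewrite mulmx_sum_row; apply: big_ind => // q _; rewrite rowA; apply: NZ; by case: (gP q).
(* Reduction by leading coordinates; the bound [k] records that only generators leading at ranks
   below [k] are used, which controls the corrected relations later. *)
have repr k v : N v -> (forall j, (k <= r j)%N -> v 0 j = 0) ->
    exists2 w, v = w *m A & forall q, (k <= r (ci q))%N -> w 0 q = 0.
  elim: k v => [|k IHk] v Nv upv.
    by exists 0 => [|q _]; rewrite ?mul0mx ?mxE //; apply/rowP => j; rewrite upv ?mxE.
  have [/existsP[i /eqP ri]|/existsPn none] := boolP [exists i, r i == k]; last first.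
    have [j lej|w -> upw] := IHk v Nv.
      by apply: upv; rewrite ltn_neqAle lej eq_sym none.
    by exists w => // q /ltnW/upw.
  have [w0 w0i upw0] : exists2 w : 'rV_#|T|, (w *m A) 0 i = v 0 i & forall q, ci q != i -> w 0 q = 0.
    have : leading_ideal N r i (v 0 i) by exists v; split=> // j; rewrite ri => /upv.
    move/NV; move: (v 0 i) => f; move: f; apply: ideal_gen_ind.
    - by exists 0 => [|q _]; rewrite ?mul0mx !mxE.
    - move=> _ _ [w1 <- up1] [w2 <- up2]; exists (w1 + w2) => [|q neq].
        by rewrite mulmxDl mxE.
      by rewrite mxE up1 ?up2 ?addr0.
    - move=> a _ [b /cP[q [eqi <-]] ->]; exists (a *: delta_mx 0 q) => [|q' neq].
        by rewrite -scalemxAl deltaA mxE -eqi; case: (gP q) => _ ->.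
      rewrite !mxE eqxx /=; have [eqq|_] := eqVneq q' q; last by rewrite mulr0.
      by rewrite eqq eqi eqxx in neq.
  have [||w1 ev1 upw1] := IHk (v - w0 *m A).
  - by apply: ND => //; rewrite -scaleN1r; apply: NZ.
  - move=> j; rewrite mxE leq_eqVlt => /orP[/eqP ek|ltk].
      by have -> : j = i; [apply: rI; rewrite ri -ek|rewrite mxE w0i subrr].
    rewrite upv // mxE mxE big1 ?subr0 // => q _; have [eqi|/upw0->] := eqVneq (ci q) i.
      by rewrite Aij; case: (gP q) => _ _ ->; rewrite ?mulr0 // eqi ri.
    by rewrite mul0r.
  exists (w1 + w0) => [|q ltq]; first by rewrite mulmxDl -ev1 subrK.
  rewrite mxE upw1 ?upw0 ?addr0 // 1?ltnW //.
  by apply: contraTneq ltq => ->; rewrite ri ltnn.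
have homA q j : A q j \is 1.-homog by rewrite Aij; case: (gP q).
exists #|T|, A; split=> // [v|].
  split=> [Nv|[w ->] //].
  (* The chosen bound exceeds every rank, so the vanishing condition is vacuous. *)
  have [|w ev _] := repr (\sum_j (r j).+1)%N v Nv; last by exists w.
  by move=> j; rewrite (bigD1 j) //= leqNgt addSn ltnS leq_addr.
split; first exact: kernel_graded_submodule homA.
(* Lexicographic rank of a pair: the leading coordinate first, then the index of the variable, which
   is below [n]. *)
pose r' q := (r (ci q) * n + cv q)%N.
have r'E q q' : (r' q < r' q')%N = (r (ci q) < r (ci q'))%N || ((ci q == ci q') && (cv q < cv q')%N).
  by rewrite ltn_lex // (inj_eq rI).
have r'I : injective r'.
  move=> q q' e; apply: enum_val_inj; have := r'E q q'; have := r'E q' q.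
  rewrite e ltnn [ci q' == _]eq_sym => /esym/norP[ge1 nl1] /esym/norP[ge2 nl2].
  have ei : ci q = ci q' by apply: rI; apply/eqP; rewrite eqn_leq ![(r _ <= r _)%N]leqNgt ge1 ge2.
  move: nl1 nl2; rewrite ei eqxx /= => nl1 nl2.
  have ea : cv q = cv q' by apply/val_inj/eqP; rewrite /= eqn_leq ![(cv _ <= cv _)%N]leqNgt nl1 nl2.
  by move: ei ea; rewrite /ci /cv; case: (enum_val q) (enum_val q') => [x y] [x' y'] /= -> ->.
exists r' => // q; exists [set b in V (ci q) | (b < cv q)%N] => f; split.
  case=> w [wA <- upw]; have [_ gq _ _] := gP q.
  pose P := @meets n [set b in V (ci q) | (b < cv q)%N].
  (* The relation is read at the coordinate [ci q]. Later generators have coefficient 0, earlier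
     ones with another leading coordinate vanish there, and the remaining ones contribute multiples
     of smaller variables. *)
  have Pwq : mon_ideal P (w 0 q * 'X_(cv q)).
    move/rowP/(_ (ci q)): wA; rewrite !mxE (bigD1 q) //= Aij gq => /eqP.
    rewrite addr_eq0 => /eqP->; apply: mon_idealN; apply: (big_ind (mon_ideal P)) => //.
    - exact: mon_ideal0.
    - exact: mon_idealD.
    move=> q' neq; case: (ltngtP (r' q) (r' q')) => [/upw->|lt|/r'I eq'].
    - by rewrite mul0r; apply: mon_ideal0.
    - move: lt; rewrite r'E Aij => /orP[lt|/andP[/eqP eqi ltv]].
        by case: (gP q') => _ _ -> // _; rewrite mulr0; apply: mon_ideal0.
      rewrite -eqi; case: (gP q') => _ -> _ _; apply: mon_ideal_mull; first exact: meets_upward.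
      apply/mon_idealX; exists (cv q'); last by rewrite mnm1E eqxx.
      by rewrite inE -eqi cvV.
    - by rewrite eq' eqxx in neq.
  apply/var_idealE => u uw; have : (u + U_(cv q))%MM \in msupp (w 0 q * 'X_(cv q)).
    by rewrite mcoeff_msupp addmC mcoeffMX -mcoeff_msupp.
  (* The variable [cv q] is not smaller than itself, so the smaller variable dividing the product
     already divides the monomial [u]. *)
  move/Pwq => [j jB pos]; exists j => //; move: jB pos; rewrite inE mnmDE mnm1E.
  by case: eqP => [<-|_]; rewrite ?ltnn ?andbF // addn0.
move: f; apply: ideal_gen_ind.
- by exists 0; split=> [||j _]; rewrite ?mul0mx ?mxE.
- move=> _ _ [w1 [A1 <- up1]] [w2 [A2 <- up2]]; exists (w1 + w2); split=> [||j lt].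
  + by rewrite mulmxDl A1 A2 addr0.
  + by rewrite mxE.
  + by rewrite mxE up1 ?up2 ?addr0.
move=> a _ [b + ->]; rewrite inE => /andP[/cP[q' [eqi <-]] ltb].
have [Ng gq upg homg] := gP q; have [Ng' gq' upg' homg'] := gP q'.
have ltq : (r' q' < r' q)%N by rewrite r'E eqi eqxx ltb orbT.
have neq : q != q' by apply: contraTneq ltq => ->; rewrite ltnn.
have [||w1 ew1 upw1] := repr (r (ci q)) ('X_(cv q') *: g q - 'X_(cv q) *: g q').
- by apply: ND; [apply: NZ|rewrite -scaleNr; apply: NZ].
- move=> j; rewrite leq_eqVlt => /orP[/eqP/rI<-|ltj].
    by rewrite !mxE gq -eqi gq' mulrC subrr.
  by rewrite !mxE upg // upg' ?eqi // !mulr0 subrr.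
exists (a *: ('X_(cv q') *: delta_mx 0 q - 'X_(cv q) *: delta_mx 0 q' - w1)); split=> [||j ltj].
- by rewrite -scalemxAl !mulmxBl -!scalemxAl !deltaA -ew1 subrr scaler0.
- by rewrite !mxE !eqxx (negPf neq) upw1 // !mulr0 mulr1 !subr0.
have nej : j != q by apply: contraTneq ltj => ->; rewrite ltnn.
have nej' : j != q' by apply: contraTneq (ltn_trans ltq ltj) => ->; rewrite ltnn.
have w1j : w1 0 j = 0.
  by apply: upw1; move: ltj; rewrite r'E => /orP[/ltnW|/andP[/eqP-> _]].
by rewrite !mxE (negPf nej) (negPf nej') w1j andbF !mulr0 !subrr mulr0.
Qed.

(** The rank changes at each step; bundling it with the module lets [iter] produce the whole
    sequence. *)
Record syzygies := Syzygies {
  syz_rank : nat;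
  syz_module : 'rV[S]_syz_rank -> Prop;
  syz_led : variable_led syz_module
}.

(** Choice turns the existence of a step into data, since a resolution is a sequence of matrices. *)
Lemma syzygies_next (s : syzygies) :
  {tA : {t : syzygies & 'M[S]_(syz_rank t, syz_rank s)} |
    [/\ forall k l, projT2 tA k l \is 1.-homog,
        forall v, syz_module v <-> exists w, v = w *m projT2 tA &
        forall w : 'rV_(syz_rank (projT1 tA)), syz_module w <-> w *m projT2 tA = 0]}.
Proof.
apply: constructive_indefinite_description.
have [p [A [homA genA ledA]]] := variable_led_step (syz_led s).
by exists (existT (fun t => 'M[S]_(syz_rank t, syz_rank s)) (Syzygies ledA) A).
Qed.

Definition next_syz s := projT1 (sval (syzygies_next s)).
Definition syz_gens s : 'M[S]_(syz_rank (next_syz s), syz_rank s) :=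
  projT2 (sval (syzygies_next s)).

(** The generators in homological degree [i] all have degree d + i, in accordance with the linear
    entries of the matrices. *)
Definition syz_complex s d (a : 'cV[S]_(syz_rank s)) : free_complex :=
  @FreeComplex n K (fun i => syz_rank (iter i next_syz s)) (fun i _ => (d + i)%N%:Z)
    (fun i => syz_gens (iter i next_syz s)) a.

(** In degree [j], Tor is a subquotient of the span of the generators of degree [j]. *)
Lemma tor_dim_generated (C : @free_complex n K) i (j : int) :
  (forall k : 'I_(frank C i), gdeg k != j) -> tor_dim C i j = 0%N.
Proof.
move=> ne; have degK0 : degK C i j = 0.
  by apply/matrixP => k l; rewrite !mxE (negPf (ne k)) mul0rn.
apply/eqP; rewrite /tor_dim mxrank_eq0 -submx0 (submx_trans (diffmxSl _ _)) //.
by rewrite degK0 capmxSr.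
Qed.

(** With coordinates ranked by position in [t], the leading ideals of the first syzygies are the
    successive colon ideals, so the syzygy module is [variable_led] and the step can be iterated. *)
Lemma linear_quotients_linear_resolution d (t : seq 'X_{1..n}) :
    (forall u, u \in t -> mdeg u = d) ->
    (forall i, (i < size t)%N -> exists A : {set 'I_n},
       same_ideal (ideal_colon (@monomial_ideal_gen n K (take i t))
                               (monomial_ideal_gen [:: nth 0%MM t i])) (var_ideal A)) ->
  linear_resolution (@monomial_ideal_gen n K t).
Proof.
move=> degt colont.
pose a : 'cV[S]_(size t) := \col_i 'X_[nth 0%MM t i].
have homa i j : a i j \is d.-homog.
  by rewrite mxE dhomogX; apply/eqP/degt/mem_nth.
have gena i f : (i <= size t)%N -> monomial_ideal_gen (take i t) f <->
    exists v : 'rV_(size t), (v *m a) 0 0 = f /\ forall j : 'I_(size t), (i <= j)%N -> v 0 j = 0.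
  move=> lei; split; last first.
    case=> v [<- upv]; apply/monomial_ideal_genE; rewrite mxE; apply: big_ind.
    - exact: mon_ideal0.
    - exact: mon_idealD.
    move=> j _; have [/upv->|lt] := leqP i j; first by rewrite mul0r; apply: mon_ideal0.
    apply: mon_ideal_mull; first exact: above_upward.
    rewrite mxE; apply/mon_idealX; exists (nth 0%MM t j); rewrite ?lepm_refl //.
    by rewrite -(nth_take 0%MM lt) mem_nth // size_takel.
  move: f; apply: ideal_gen_ind.
  - by exists 0; split=> [|j _]; rewrite ?mul0mx mxE.
  - move=> _ _ [v [<- upv]] [w [<- upw]]; exists (v + w); split=> [|j lej].
      by rewrite mulmxDl mxE.
    by rewrite mxE upv ?upw ?addr0.
  - move=> b _ [u ut ->]; have ut' := mem_take ut.
    have ltu : (index u t < size t)%N by rewrite index_mem.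
    exists (b *: delta_mx 0 (Ordinal ltu)); split=> [|j lej].
      by rewrite -scalemxAl -rowE !mxE nth_index.
    rewrite !mxE eqxx /=; have [ej|_] := eqVneq j (Ordinal ltu); last by rewrite mulr0.
    by move: ut lej; rewrite in_take // ej /= ltnNge => /negPf->.
have led : variable_led (fun v => v *m a = 0).
  split; first exact: kernel_graded_submodule homa.
  exists (@nat_of_ord (size t)); first exact: val_inj.
  move=> i; have [A colonA] := colont i (ltn_ord i); exists A => f.
  apply: iff_trans (colonA f); apply: iff_sym; apply: (iff_trans (monomial_colonE _ _ f)).
  split=> [colonf|[v [va <- upv]]].
    have : monomial_ideal_gen (take i t) (f * 'X_[nth 0%MM t i]).
      apply/monomial_ideal_genE => m /msuppM_le/allpairsP[[u w] /= [uf]].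
      by rewrite msuppX inE => /eqP-> ->; apply: colonf.
    case/gena => [|v [ev upv]]; first exact: ltnW.
    (* [v] expresses the product of [f] and the generator at [i] through the earlier generators; the
       difference is a syzygy with leading entry [f]. *)
    exists (f *: delta_mx 0 i - v); split=> [||j ltj].
    - apply/matrixP => j k; rewrite !ord1 mulmxBl -scalemxAl -rowE !mxE.
      by move: ev; rewrite mxE => ->; rewrite subrr.
    - by rewrite !mxE !eqxx mulr1 upv ?subr0.
    - rewrite !mxE eqxx upv ?(ltnW ltj) // subr0.
      by have [ej|_] := eqVneq j i; [rewrite ej ltnn in ltj|rewrite mulr0].
  move=> m mv; have : monomial_ideal_gen (take i t) (v 0 i * 'X_[nth 0%MM t i]).
    apply/gena; first exact: ltnW.
    exists (v 0 i *: delta_mx 0 i - v); split=> [|j lej].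
      by rewrite mulmxBl va subr0 -scalemxAl -rowE !mxE.
    rewrite !mxE eqxx; have [->|ne] := eqVneq j i; first by rewrite mulr1 subrr.
    by rewrite (upv j) ?mulr0 ?subr0 // ltn_neqAle lej andbT eq_sym.
  move/monomial_ideal_genE; apply.
  by rewrite mcoeff_msupp addmC mcoeffMX -mcoeff_msupp.
pose s := Syzygies led; pose C := @syz_complex s d a.
have resC : graded_free_resolution (monomial_ideal_gen t) C.
  split.
  - by move=> k m mk; have /dhomogP/(_ m mk) /= -> := homa k 0; rewrite addn0.
  - move=> i k l m; rewrite /= /syz_gens; case: (svalP (syzygies_next (iter i next_syz s))) => hom _ _.
    by move=> mkl; have /dhomogP/(_ m mkl) /= -> := hom k l; lia.
  - move=> f; rewrite -[t in monomial_ideal_gen t]take_size; apply: (iff_trans (gena _ f (leqnn _))).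
    split=> [[v [<- _]]|[v ev]]; exists v.
      by apply/matrixP => i j; rewrite !ord1 [RHS]mxE eqxx mulr1n.
    by split=> [|j]; [rewrite (_ : v *m a = f%:M) // mxE eqxx mulr1n|rewrite leqNgt ltn_ord].
  - move=> v; have [_ gen _] := svalP (syzygies_next s); exact: gen.
  - move=> i v; have [_ _ ker] := svalP (syzygies_next (iter i next_syz s)).
    have [_ gen _] := svalP (syzygies_next (iter i.+1 next_syz s)).
    by apply: iff_trans (gen v); apply: iff_sym; apply: ker.
exists d%:Z => i b neb; exists C => //; apply: tor_dim_generated => k /=.
by apply: contra neb => /eqP; lia.
Qed.
End LinearResolution.

(** * Components of cover ideals *)

Section CoverComponents.
Context {n : nat} {K : fieldType}.
Local Notation S := {mpoly K[n]}.
Implicit Types I J : S -> Prop.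

Lemma linear_resolution_ext I J : same_ideal I J -> linear_resolution I -> linear_resolution J.
Proof.
move=> eIJ [d res]; exists d => i b /(res i)[C [hom1 hom2 gen ex0 ex] tor]; exists C => //.
by split=> // f; apply: iff_trans (gen f); apply: iff_sym.
Qed.

Lemma linear_quotients_ext I J : same_ideal I J -> linear_quotients I -> linear_quotients J.
Proof.
move=> eIJ [s [[Us genI minI] colon]]; exists s; split=> //; split=> // [f|t sub genJ].
  by apply: iff_trans (genI f); apply: iff_sym.
by apply: minI => // f; apply: iff_trans (eIJ f) (genJ f).
Qed.

(** The weight of the whole vertex set is the degree; [maxn] retains the bound that [c] may already
    put on that set. *)
Lemma covers_mdeg (c : {set 'I_n} -> nat) j (m : 'X_{1..n}) :
  covers (fun F => if F == setT then maxn (c F) j else c F) m = covers c m && (j <= mdeg m)%N.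
Proof.
apply/coversP/andP => [cm|[/coversP cm lej] F].
  split; last by have := cm setT; rewrite eqxx weightT geq_max => /andP[].
  by apply/coversP => F; have := cm F; case: eqP => // _; rewrite geq_max => /andP[].
by case: eqP => [->|_]; rewrite ?geq_max ?cm ?weightT.
Qed.

(* Truncating in degree j amounts to the constraint of weight j on the whole
   vertex set, which does not disturb the elimination order; the component is
   generated by the initial segment of degree j of the minimal generators. *)
Lemma cover_ideal_component_linear (c : {set 'I_n} -> nat) (rk : 'I_n -> nat) I j :
    injective rk -> elimination_order rk [set F | (0 < c F)%N] ->
    same_ideal I (mon_ideal (covers c)) ->
  linear_resolution (degree_component_ideal I j).
Proof.
move=> rkI elim_c eI; pose c' F := if F == setT then maxn (c F) j else c F.
have elim_c' : elimination_order rk [set F | (0 < c' F)%N].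
  move=> F H l a b + + lF lH lta ltb aFH bHF; rewrite !inE /c'.
  (* The whole vertex set contains every set, so it never occurs in an incomparable pair. *)
  have [eF|_] := eqVneq F setT; first by rewrite eF !inE in bHF.
  have [eH|_] := eqVneq H setT; first by rewrite eH !inE in aFH.
  by move=> cF cH; apply: (elim_c F H l a b _ _ lF lH lta ltb aFH bHF); rewrite inE.
(* Covers for [c'] have degree at least [j], while the list stops at degree [j]. *)
have memE m : m \in minimal_covers c' rk j -> covers c m /\ mdeg m = j.
  rewrite mem_minimal_covers => /andP[/minimal_coverP[]]; rewrite covers_mdeg => /andP[cm ge] _ le.
  by split=> //; apply/eqP; rewrite eqn_leq le.
have res : linear_resolution (@monomial_ideal_gen n K (minimal_covers c' rk j)).
  apply: (@linear_quotients_linear_resolution n K j) => [u /memE[]//|i lti].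
  by eexists; apply: minimal_covers_colon.
apply: linear_resolution_ext res => f; apply: (iff_trans (monomial_ideal_genE _ f)).
have up : upward (covers c) by move=> u v; apply: covers_le.
apply: iff_sym; apply: (iff_trans (mon_ideal_component j up eI f)).
split=> If m /If [u].
  case=> cu du leu; exists u => //; rewrite mem_minimal_covers du leqnn andbT.
  have cu' : covers c' u by rewrite covers_mdeg cu du leqnn.
  (* A cover of degree [j] is minimal for [c'], since any decrement brings its degree below [j]. *)
  apply/minimal_coverP; split=> // l ul; rewrite covers_mdeg negb_and -ltnNge.
  by rewrite -du -(mdeg_subU ul) leqnn orbT.
by move=> /memE[cu du] leu; exists u.
Qed.
End CoverComponents.

Theorem theorem1p1 (n : nat) (K : fieldType) (D : {set {set 'I_n}})
    (hD : simplicial_tree D) (k : nat) (hk : (1 <= k)%N) :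
  linear_quotients (ideal_exp (@vertex_cover_ideal n K D) k) /\
  componentwise_linear (ideal_exp (@vertex_cover_ideal n K D) k).
Proof.
have leafD := simplicial_tree_leafy hD.
have eI := @ideal_exp_vertex_coverE n K D k leafD.
have [rk rkI elim_rk] := leafy_elimination_order leafD.
have elim_c : elimination_order rk [set F | (0 < k * (F \in facets D))%N].
  have posE F : F \in [set F | (0 < k * (F \in facets D))%N] -> F \in facets D.
    by rewrite in_set muln_gt0 lt0b => /andP[].
  by move=> F H l a b /posE FD /posE HD; apply: elim_rk.
split; last split.
- apply: linear_quotients_ext (cover_ideal_linear_quotients rkI elim_c) => f.
  exact: iff_sym (eI f).
- exact: mon_ideal_graded eI.
- by move=> j; apply: cover_ideal_component_linear rkI elim_c eI.
Qed.
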